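(* Let $p>5$ be a prime and let $G$ be a finitely generated group with a presentation $\langle X|R\rangle$, $X$ finite and $R$ finite or infinite, such that $\mathrm{def}_p(G;X,R)>1$. Then the presentation $\langle X|R\rangle$ satisfies the Golod-Shafarevich condition with respect to $p$ (so $G$ is Golod-Shafarevich with respect to this presentation).
   Context: For a presentation $\langle X|R\rangle$ of $G$ with $X$ finite and $R$ a subset (finite or infinite) of the free group $F(X)$, the $p$-deficiency is $\mathrm{def}_p(G;X,R)=|X|-\sum_{r\in R}p^{-\nu_p(r)}$, where $\nu_p(r)=\max\{k\ge 0 : \exists w\in F(X),\ w^{p^k}=r\}$; if $R$ is infinite and the sum does not converge, then $\mathrm{def}_p(G;X,R)=-\infty$. The Zassenhaus $p$-filtration $\{G_n\}$ of a group $G$ is given by $G_1=G$ and $G_i=[G_{i-1},G]\,G_{\lceil i/p\rceil}^p$ for $i\ge 2$. For a non-identity $w\in F(X)$, the degree $\deg(w)$ (with respect to $p$) is the maximum $i$ such that $w\in F(X)_i$. A presentation $\langle X|R\rangle$ with $X$ finite and $R=\{r_1,r_2,\ldots\}$ finite or infinite satisfies the Golod-Shafarevich condition with respect to $p$ if there exists a real number $t\in(0,1)$ such that $1-|X|t+\sum_{i}t^{\deg(r_i)}<0$. A group is Golod-Shafarevich (with respect to $p$) if it has a presentation satisfying this condition. *)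

(* Defs.v *)
From HB Require Import structures.
From mathcomp Require Import all_boot all_order all_algebra zify.
From mathcomp Require Import all_classical all_reals ereal esum.

Set Implicit Arguments.
Unset Strict Implicit.
Unset Printing Implicit Defensive.

Import Order.TTheory GRing.Theory Num.Theory.

(* The free group on X: reduced words in the letters (x, true), standing for   *)
(* x, and (x, false), standing for x^-1.                                       *)
Section FreeGroup.
Variable X : choiceType.
Implicit Types (a b : X * bool) (u v w : seq (X * bool)).

Definition letter_inv a : X * bool := (a.1, ~~ a.2).

Definition reduced w : bool := sorted (fun a b => b != letter_inv a) w.

Record free_group := FreeGroup { word : seq (X * bool); _ : reduced word }.

HB.instance Definition _ := [isSub for word].
HB.instance Definition _ := [Choice of free_group by <:].

Definition push a w : seq (X * bool) :=
  if w is b :: w' then if b == letter_inv a then w' else a :: w else [:: a].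

Definition word_mul u v := foldr push v u.
Definition word_inv w := rev (map letter_inv w).

Lemma letter_invK : involutive letter_inv.
Proof. by case=> x b; rewrite /letter_inv /= negbK. Qed.

Lemma push_reduced a w : reduced w -> reduced (push a w).
Proof.
case: w => [|b w] //= rw; case: eqP => [_|/eqP ba]; last by rewrite /= ba rw.
exact: path_sorted rw.
Qed.

Lemma pushK a w : reduced w -> push (letter_inv a) (push a w) = w.
Proof.
case: w => [|b w] /=; first by rewrite letter_invK eqxx.
case: eqP => [->|_] rw; last by rewrite /= letter_invK eqxx.
by case: w rw => [|c w] //= /andP[/negPf ->].
Qed.

Lemma word_mul_reduced u v : reduced v -> reduced (word_mul u v).
Proof. by move=> rv; elim: u => //= a u; apply: push_reduced. Qed.

Lemma word_inv_reduced w : reduced w -> reduced (word_inv w).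
Proof.
rewrite /reduced /word_inv rev_sorted sorted_map; apply: sub_sorted => a b /=.
by apply: contra => /eqP ->; rewrite letter_invK.
Qed.

Lemma word_mulA u v w :
  reduced w -> word_mul (word_mul u v) w = word_mul u (word_mul v w).
Proof.
move=> rw; elim: u => //= a u <-.
case: (word_mul u v) => [|b s] //=; case: eqP => [->|_] //=.
have := pushK (letter_inv a) (word_mul_reduced s rw).
by rewrite letter_invK => ->.
Qed.

Lemma word_mulw1 w : reduced w -> word_mul w [::] = w.
Proof.
elim: w => //= a w IHw rw; have -> := IHw (path_sorted rw).
by case: w rw {IHw} => [|b w] //= /andP[/negPf ->].
Qed.

Lemma word_mulVw w : word_mul (word_inv w) w = [::].
Proof.
elim: w => //= a w IHw.
by rewrite /word_inv /= rev_cons /word_mul foldr_rcons /= letter_invK eqxx.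
Qed.

Definition free_one : free_group := FreeGroup (isT : reduced [::]).
Definition free_mul (g h : free_group) : free_group :=
  FreeGroup (word_mul_reduced (word g) (valP h)).
Definition free_inv (g : free_group) : free_group :=
  FreeGroup (word_inv_reduced (valP g)).

Lemma free_mulA : associative free_mul.
Proof. by move=> g h k; apply/val_inj; rewrite /= word_mulA ?(valP k). Qed.

Lemma free_mul1g : left_id free_one free_mul.
Proof. by move=> g; apply/val_inj. Qed.

Lemma free_mulg1 : right_id free_one free_mul.
Proof. by move=> g; apply/val_inj; rewrite /= word_mulw1 ?(valP g). Qed.

Lemma free_mulVg : left_inverse free_one free_inv free_mul.
Proof. by move=> g; apply/val_inj; rewrite /= word_mulVw. Qed.

Lemma free_mulgV : right_inverse free_one free_inv free_mul.
Proof.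
move=> g; rewrite -[LHS]free_mul1g -{1}(free_mulVg (free_inv g)) -free_mulA.
by rewrite (free_mulA (free_inv g)) free_mulVg free_mul1g free_mulVg.
Qed.

HB.instance Definition _ := isGroup.Build free_group
  free_mulA free_mul1g free_mulg1 free_mulVg free_mulgV.

Definition free_gen (x : X) : free_group :=
  FreeGroup (isT : reduced [:: (x, true)]).

End FreeGroup.

Local Open Scope group_scope.

Definition letter_eval (X : Type) (G : groupType) (f : X -> G) (a : X * bool) :
  G := if a.2 then f a.1 else (f a.1)^-1.

Definition free_lift (X : choiceType) (G : groupType) (f : X -> G)
    (w : free_group X) : G :=
  \prod_(a <- word w) letter_eval f a.

Lemma free_liftM (X : choiceType) (G : groupType) (f : X -> G) :
  {morph free_lift f : v w / v * w}.
Proof.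
move=> v w; rewrite /free_lift /= /word_mul.
elim: (word v) => [|a u IHu] /=; first by rewrite big_nil mul1g.
rewrite big_cons -mulgA -IHu.
case: (foldr _ _ _) => [|b s] /=; first by rewrite big_cons.
case: eqP => [->|_]; last by rewrite big_cons.
rewrite big_cons mulgA /letter_eval /=.
by case: a.2; rewrite /= ?mulgV ?mulVg mul1g.
Qed.

Lemma free_lift_gen (X : choiceType) (G : groupType) (f : X -> G) (x : X) :
  free_lift f (free_gen x) = f x.
Proof. by rewrite /free_lift big_seq1. Qed.

Section Subgroups.
Local Open Scope classical_set_scope.
Variable G : groupType.
Implicit Types (A B H : set G).

Definition is_subgroup H : Prop :=
  [/\ H 1, forall x y, H x -> H y -> H (x * y) & forall x, H x -> H x^-1].

Definition is_normal_subgroup H : Prop :=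
  is_subgroup H /\ forall x y, H x -> H (x ^ y).

Definition generated A : set G := smallest is_subgroup A.

Definition normal_closure A : set G := smallest is_normal_subgroup A.

Definition finitely_generated : Prop :=
  exists A : set G, finite_set A /\ generated A = setT.

Definition commutator_subgroup A B : set G :=
  generated [set [~ x, y] | x in A & y in B].

Definition power_subgroup (n : nat) A : set G :=
  generated [set x ^+ n | x in A].

Definition set_product A B : set G := [set x * y | x in A & y in B].

Definition ceil_div (i p : nat) : nat := ((i + p).-1 %/ p)%N.

(* G_i is defined by strong recursion on i; [fuel] makes it structural, and   *)
(* zassenhausE is the recursion it implements.                                *)
Fixpoint zassenhaus_rec (p fuel i : nat) : set G :=
  if fuel is fuel'.+1 then
    if (i <= 1)%N then setT else
    set_product
      (commutator_subgroup (zassenhaus_rec p fuel' i.-1) setT)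
      (power_subgroup p (zassenhaus_rec p fuel' (ceil_div i p)))
  else setT.

Definition zassenhaus (p i : nat) : set G := zassenhaus_rec p i i.

Lemma ceil_div_lt (p i : nat) : (1 < p)%N -> (1 < i)%N -> (ceil_div i p < i)%N.
Proof.
move=> p1 i1; have p0 : (0 < p)%N by apply: leq_trans p1.
rewrite /ceil_div ltn_divLR // prednK ?addn_gt0 ?p0 ?orbT //.
nia.
Qed.

Lemma zassenhaus_rec_fuel (p f1 f2 i : nat) : (1 < p)%N ->
  (i <= f1)%N -> (i <= f2)%N -> zassenhaus_rec p f1 i = zassenhaus_rec p f2 i.
Proof.
move=> p1; elim: f1 f2 i => [|f1 IH] [|f2] i //=.
- by rewrite leqn0 => /eqP -> _.
- by move=> _; rewrite leqn0 => /eqP ->.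
move=> i1 i2; case: leqP => // i_gt1.
rewrite (IH f2 i.-1) ?(IH f2 (ceil_div i p)) //.
- by rewrite -ltnS (leq_trans (ceil_div_lt p1 i_gt1)).
- by rewrite -ltnS (leq_trans (ceil_div_lt p1 i_gt1)).
- by case: i i_gt1 i1 {i2}.
- by case: i i_gt1 i2 {i1}.
Qed.

Lemma zassenhaus1 (p : nat) : zassenhaus p 1 = setT.
Proof. by []. Qed.

Lemma zassenhausE (p i : nat) : (1 < p)%N -> (1 < i)%N ->
  zassenhaus p i =
  set_product (commutator_subgroup (zassenhaus p i.-1) setT)
              (power_subgroup p (zassenhaus p (ceil_div i p))).
Proof.
move=> p1; case: i => // i i1; rewrite /zassenhaus /= leqNgt i1 /=.
rewrite (@zassenhaus_rec_fuel p i (ceil_div i.+1 p) (ceil_div i.+1 p)) //.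
by rewrite -ltnS ceil_div_lt.
Qed.

End Subgroups.

Local Open Scope classical_set_scope.

(* None stands for infinity, the value on sets without a maximum. In a free    *)
(* group, nu and degree take it exactly at 1, which thus contributes 0 to the  *)
(* sums below if it is a relator.                                             *)
Definition nat_max (A : set nat) : option nat :=
  xget None [set o | exists2 n, o = Some n & A n /\ forall m, A m -> (m <= n)%N].

Definition nu (p : nat) (G : groupType) (r : G) : option nat :=
  nat_max [set k | exists w : G, w ^+ (p ^ k)%N = r].

Definition degree (p : nat) (G : groupType) (w : G) : option nat :=
  nat_max [set i | (0 < i)%N /\ zassenhaus p i w].

Definition is_presentation (X : finType) (R : set (free_group X))
    (G : groupType) : Prop :=
  exists f : X -> G,
    (forall g : G, exists w, free_lift f w = g) /\
    [set w | free_lift f w = 1] = normal_closure R.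

Local Open Scope ring_scope.
Local Open Scope ereal_scope.

(* x ^ n with the convention x ^ oo = 0 (for 0 <= x < 1). *)
Definition pow_opt (K : realType) (x : K) (n : option nat) : K :=
  (if n is Some k then x ^+ k else 0)%R.

(* The sum over R is esum, a supremum of finite partial sums in \bar K, so the *)
(* p-deficiency is -oo when it diverges.                                      *)
Definition p_deficiency (K : realType) (p : nat) (X : finType)
    (R : set (free_group X)) : \bar K :=
  #|X|%:R%:E - \esum_(r in R) (pow_opt p%:R^-1 (nu p r))%:E.

Definition golod_shafarevich_condition (K : realType) (p : nat) (X : finType)
    (R : set (free_group X)) : Prop :=
  exists t : K, (0 < t < 1)%R /\
    (1 - (#|X|%:R * t)%:E + \esum_(r in R) (pow_opt t (degree p r))%:E < 0).

Definition golod_shafarevich_group (K : realType) (p : nat) (G : groupType) :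
    Prop :=
  exists (X : finType) (R : set (free_group X)),
    is_presentation R G /\ golod_shafarevich_condition K p R.

(* Main.v *)
(* A relator [w ^ (p ^ k)] has degree at least [p ^ k]. At [t = 3/5] and for   *)
(* [p >= 7], [N t^N <= 7 t^7 < 1/5] at [N = p ^ k], [k > 0], so a relator that *)
(* is a p-th power contributes to the Golod-Shafarevich sum at most            *)
(* [c = 49/250 < 1/5] times its weight [p ^- k]; the others contribute at most *)
(* [t]. The number [n] of the others is an integer, so a p-deficiency above 1  *)
(* gives [m = |X| - n >= 2], and the p-th powers have total weight below       *)
(* [m - 1]. The Golod-Shafarevich value is thus at most                        *)
(* [1 - t m + c (m - 1)], which decreases in [m] and is negative at [m = 2].   *)
Require Import Defs.
From mathcomp Require Import all_boot all_order all_algebra finmap lra.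
From mathcomp Require Import all_classical all_reals ereal esum.

Set Implicit Arguments.
Unset Strict Implicit.
Unset Printing Implicit Defensive.

Import Order.TTheory GRing.Theory Num.Theory.

(** Taking p-th powers multiplies depth in the Zassenhaus filtration by p, so a relator of small
    weight in the p-deficiency has large degree ([zassenhaus_expX]). For relators that are p-th
    powers this gives a termwise comparison of the two sums ([pow_opt_degree_weight]). Each other
    relator weighs exactly 1 in the p-deficiency, so their total weight is a natural number
    ([esum1_nat]); this integrality sharpens the strict bound enough for one fixed [t] to work. *)

Lemma ceil_divMl (p i : nat) : (0 < p)%N -> ceil_div (p * i) p = i.
Proof.
move=> p0; rewrite /ceil_div -subn1 -addnBA // subn1 mulnC divnMDl //.
by rewrite divn_small ?addn0 // prednK.
Qed.

(** In the recursion at [p * i] the power factor is built from level [i], since rounding up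
    [p * i / p] gives [i]; the commutator factor is taken to be 1. *)
Lemma zassenhausX (G : groupType) (p i : nat) (w : G) :
  (1 < p)%N -> (0 < i)%N -> zassenhaus p i w -> zassenhaus p (p * i) (w ^+ p)%g.
Proof.
move=> p1 i0 wi; have p0 := ltnW p1.
rewrite zassenhausE //; last by rewrite (leq_trans p1) // leq_pmulr.
rewrite ceil_divMl //; exists 1%g; first by move=> H [[]].
by exists (w ^+ p)%g; rewrite ?mul1g // => H [_]; apply; exists w.
Qed.

Lemma zassenhaus_expX (G : groupType) (p k : nat) (w : G) :
  (1 < p)%N -> zassenhaus p (p ^ k) (w ^+ (p ^ k)%N)%g.
Proof.
move=> p1; elim: k => [|k IHk]; first by rewrite zassenhaus1.
by rewrite expnS [X in (w ^+ X)%g]mulnC expgnA; apply: zassenhausX;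
  rewrite ?expn_gt0 ?(ltnW p1).
Qed.

(** For nonempty [A], the default [None] can only mean that [A] is unbounded, since a bounded
    nonempty set of naturals has a maximum. *)
Lemma nat_maxP (A : set nat) (n : nat) : A n ->
  if nat_max A is Some m then A m /\ (forall k, A k -> (k <= m)%N)
  else forall m, exists2 k, A k & (m <= k)%N.
Proof.
move=> An; rewrite /nat_max; case: xgetP => [_ -> [m -> //]|noA m].
apply: contrapT => Am_ub.
have ub k : `[< A k >] -> (k <= m)%N.
  by move=> /asboolP Ak; apply/ltnW; rewrite ltnNge; apply/negP => mk;
    apply: Am_ub; exists k.
have exA : exists k, `[< A k >] by exists n; apply/asboolP.
case: (ex_maxnP exA ub) => x /asboolP Ax x_max.
by apply: (noA (Some x)); exists x => //; split=> // k /asboolP; apply: x_max.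
Qed.

Local Open Scope classical_set_scope.
Local Open Scope ring_scope.

Section Relators.
Variables (K : realType) (p : nat) (G : groupType).
Hypothesis p1 : (1 < p)%N.
Implicit Types (t : K) (w : G).

Lemma pow_opt_degree_le t w (i : nat) : 0 <= t <= 1 ->
  (0 < i)%N -> zassenhaus p i w -> pow_opt t (degree p w) <= t ^+ i.
Proof.
move=> /andP[t0 t1] i0 wi; rewrite /pow_opt /degree.
have := @nat_maxP [set j | (0 < j)%N /\ zassenhaus p j w] i (conj i0 wi).
case: nat_max => [m [_ /(_ i (conj i0 wi)) im]|_]; last exact: exprn_ge0.
exact: ler_wiXn2l.
Qed.

(** Roots of order [p ^ k] for arbitrarily large [k] put [w] in arbitrarily deep terms of the
    filtration. Such a relator, for instance 1, thus contributes 0 to both sums. *)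
Lemma degree_nu_oo w : nu p w = None -> degree p w = None.
Proof.
have A0 : [set k | exists v : G, (v ^+ (p ^ k)%N)%g = w] 0%N.
  by exists w; rewrite /= expn0 expg1.
rewrite /nu /degree => nuN; have := nat_maxP A0; rewrite nuN => unb.
have D1 : [set i | (0 < i)%N /\ zassenhaus p i w] 1%N by [].
have := nat_maxP D1; case: nat_max => // m [_ m_max].
have [k [v vk] mk] := unb m.
have /m_max : (0 < p ^ k)%N /\ zassenhaus p (p ^ k) w.
  by split; [rewrite expn_gt0 ltnW|rewrite -vk; exact: zassenhaus_expX].
by rewrite leqNgt (leq_ltn_trans mk (ltn_expl k p1)).
Qed.

Lemma pow_opt_degree_nu t w (k : nat) : 0 <= t <= 1 ->
  nu p w = Some k -> pow_opt t (degree p w) <= t ^+ (p ^ k).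
Proof.
move=> t01; have A0 : [set k | exists v : G, (v ^+ (p ^ k)%N)%g = w] 0%N.
  by exists w; rewrite /= expn0 expg1.
have := nat_maxP A0; rewrite /nu => /[swap] -> [[v <-] _].
by apply: pow_opt_degree_le => //; [rewrite expn_gt0 ltnW|exact: zassenhaus_expX].
Qed.

End Relators.

(** At 7 the value is 15309/78125, just below 49/250. Passing from [n] to [n + 1] multiplies it by
    [3/5 * (n + 1)/n], which is less than 1. *)
Lemma mul_exp_three_fifths (K : realFieldType) (n : nat) : (7 <= n)%N ->
  n%:R * (3 / 5) ^+ n <= 49 / 250 :> K.
Proof.
move=> /subnK <-; elim: (n - 7)%N => [|m]; first by rewrite add0n; lra.
rewrite addSn; set N := (m + 7)%N => IHm.
have N7 : 7 <= N%:R :> K by rewrite ler_nat leq_addl.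
apply: le_trans IHm; rewrite exprS mulrA ler_pM2r ?exprn_gt0 //; lra.
Qed.

Local Open Scope ereal_scope.

Lemma esum_le_mule (K : realType) (T : choiceType) (I : set T)
    (a b : T -> \bar K) (c : K) : (0 <= c)%R -> (forall i, 0 <= b i) ->
  (forall i, I i -> a i <= c%:E * b i) ->
  \esum_(i in I) a i <= c%:E * \esum_(i in I) b i.
Proof.
move=> c0 b0 ab; apply: ge_ereal_sup => _ [F [finF FI] <-].
apply: (@le_trans _ _ (c%:E * \sum_(i \in F) b i)).
  by rewrite ge0_mule_fsumr //; apply: lee_fsum => // i /FI; exact: ab.
by rewrite lee_wpmul2l ?lee_fin //; apply: esum_ge; exists F.
Qed.

(** The sum counts [I]: an infinite [I] has finite subsets of every size, so its sum exceeds every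
    real. *)
Lemma esum1_nat (K : realType) (T : choiceType) (I : set T) :
  \esum_(i in I) (1 : \bar K) < +oo ->
  exists n : nat, \esum_(i in I) (1 : \bar K) = n%:R%:E.
Proof.
have sum1 (F : set T) : finite_set F ->
    \sum_(i \in F) (1 : \bar K) = #|` fset_set F|%:R%:E.
  move=> finF; rewrite fsbig_finite //= sumEFin.
  by rewrite big_const_seq count_predT iter_addr addr0.
move=> fin_sum; have [finI|infI] := pselect (finite_set I).
  by exists #|` fset_set I|; rewrite esum_fset ?sum1.
suff oo : \esum_(i in I) (1 : \bar K) = +oo by rewrite oo in fin_sum.
apply/eqyP => A A0; have [F FI cF] := infinite_set_fset (Num.truncn A).+1 infI.
apply: esum_ge; exists [set` F]; first by split.
rewrite sum1 // set_fsetK lee_fin.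
apply/ltW/(lt_le_trans (truncnS_gt A)).
by rewrite ler_nat.
Qed.

Section Presentation.
Variables (K : realType) (p : nat) (G : groupType).
Hypothesis p7 : (7 <= p)%N.
Let p1 : (1 < p)%N := leq_trans (isT : 1 < 7)%N p7.
Let t : K := (3 / 5)%R.
Let t01 : (0 <= t <= 1)%R.
Proof. by rewrite /t; lra. Qed.

Lemma pow_opt_degree_weight (w : G) : nu p w <> Some 0%N ->
  (pow_opt t (degree p w) <= 49 / 250 * pow_opt p%:R^-1 (nu p w))%R.
Proof.
case nuE: (nu p w) => [[|k]|] // _; last first.
  by rewrite /pow_opt (degree_nu_oo p1 nuE) mulr0.
apply: le_trans (pow_opt_degree_nu p1 t01 nuE) _.
(* With [N = p ^ k.+1], the weight is [1 / N], so the claim is [N * t ^ N <= 49 / 250], where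
   [N >= p >= 7]. *)
rewrite /= exprVn ler_pdivlMr ?exprn_gt0 ?ltr0n ?(ltnW p1) //.
rewrite -natrX mulrC mul_exp_three_fifths // (leq_trans p7) //.
by rewrite expnS leq_pmulr // expn_gt0 (ltnW p1).
Qed.

End Presentation.

Theorem theorem5p2 (K : realType) (p : nat) (p_prime : prime p)
    (p_gt5 : (5 < p)%N) (G : groupType) (G_fg : finitely_generated G)
    (X : finType) (R : set (free_group X)) (G_pres : is_presentation R G)
    (def_gt1 : (1 < p_deficiency K p R)%E) :
  golod_shafarevich_condition K p R /\ golod_shafarevich_group K p G.
Proof.
have p7 : (7 <= p)%N.
  by rewrite ltn_neqAle p_gt5 andbT; apply: contraTneq p_prime => <-.
suff GS : golod_shafarevich_condition K p R by split => //; exists X, R.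
exists (3 / 5)%R; split; first by lra.
set wt := fun r : free_group X => (pow_opt (p%:R^-1 : K) (nu p r))%:E.
have wt0 r : 0 <= wt r.
  by rewrite lee_fin /pow_opt; case: nu => // k; rewrite exprn_ge0 ?invr_ge0.
(* The relators that are not p-th powers, each of weight 1; both sums are split along [B]. *)
set B := [set r : free_group X | nu p r = Some 0%N].
have dg0 r : 0 <= (pow_opt (3 / 5 : K) (degree p r))%:E :> \bar K.
  by rewrite lee_fin /pow_opt; case: degree => // k; rewrite exprn_ge0 //; lra.
move: def_gt1; rewrite /p_deficiency -/wt (esumID B R wt) //.
rewrite (esumID B R (fun r : free_group X => (pow_opt _ (degree p r))%:E)) //.
have -> : \esum_(r in R `&` B) wt r = \esum_(r in R `&` B) 1.
  by apply: eq_esum => r [_]; rewrite /wt /B /= => ->; rewrite /= expr0.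
have := @esum_ge0 _ _ (R `&` ~` B) wt (fun r _ => wt0 r).
set s := \esum_(r in R `&` ~` B) wt r => s0 def_gt1.
(* Infinitely many relators in [B] would make the p-deficiency [-oo]. *)
have [n nE] : exists n : nat, \esum_(r in R `&` B) (1 : \bar K) = n%:R%:E.
  apply: esum1_nat; rewrite ltey; apply/eqP => oo; move: def_gt1.
  by rewrite oo; case: s s0.
have leB : \esum_(r in R `&` B) (pow_opt (3 / 5 : K) (degree p r))%:E
    <= (3 / 5 : K)%:E * n%:R%:E.
  rewrite -nE; apply: esum_le_mule => // r [_ rB]; rewrite mule1 lee_fin.
  apply: (le_trans (pow_opt_degree_nu _ _ rB)) => //; last by lra.
  exact: leq_trans p7.
have leC : \esum_(r in R `&` ~` B) (pow_opt (3 / 5 : K) (degree p r))%:E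
    <= (49 / 250 : K)%:E * s.
  apply: esum_le_mule => // r [_ rB].
  by rewrite lee_fin; apply: pow_opt_degree_weight.
apply: le_lt_trans (leeD2l _ (leeD leB leC)) _.
move: def_gt1 s0; rewrite nE; case: s {leC} => [s| |] //.
rewrite -!EFinD -?EFinM -?EFinN -?EFinD !lte_fin lee_fin => def_gt1 s0.
(* The hypothesis now reads [1 < #|X| - (n + s)] with [s >= 0], so [n + 1 < #|X|], and both sides
   are integers. *)
have nX : (n.+2 <= #|X|)%N by rewrite -(ltr_nat K) -natr1; lra.
have : (n%:R + 2 <= #|X|%:R :> K)%R by rewrite -natrD ler_nat addn2.
(* With [m = #|X| - n] and [s < m - 1], the value is below [201/250 - 101/250 * m], which is
   [-1/250] at [m = 2]. *)
lra.
Qed.
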